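(* Let $(\Omega,\mathcal F,(\mathcal F_t)_{t\in\mathbb N_0})$ be a filtered measurable space, $\mathcal P$ a family of probability measures on $(\Omega,\mathcal F)$, $Q$ a probability measure on $(\Omega,\mathcal F)$, and $I\in(0,\infty)$. Let $k_0\ge16$ be an integer. Define $$S_\star:=\sum_{k=k_0}^\infty\frac1{k\log k(\log\log k)^2},\qquad c_\star:=\frac1{S_\star},\qquad \gamma_k:=\frac{c_\star}{k\log k(\log\log k)^2}\quad(k\ge k_0).$$ For each $k\ge k_0$ let $\tau_{\gamma_k}$ be an $(\mathcal F_t)$-stopping time with values in $\mathbb N_0\cup\{\infty\}$ such that $\sup_{P\in\mathcal P}P(\tau_{\gamma_k}<\infty)\le\gamma_k$, and let $G_t:=\sum_{k=k_0}^\infty\mathbf 1_{\{\tau_{\gamma_k}\le t\}}$ for $t\in\mathbb N_0$. Assume that $\frac{\tau_{\gamma_k}}{\log(1/\gamma_k)}\to\frac1I$ $Q$-almost surely as $k\to\infty$. Then $S_\star<\infty$, $G$ is a $\mathcal P$-$e$-process, and $Q$-almost surely as $t\to\infty$, $$\frac1t\log G_t\longrightarrow I.$$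
   Context: A nonnegative adapted process $M=(M_t)_{t\in\mathbb N_0}$ (values in $[0,\infty]$ allowed) is a $\mathcal P$-$e$-process if $\mathbb E_P[M_\sigma]\le1$ for every $P\in\mathcal P$ and every finite $(\mathcal F_t)$-stopping time $\sigma$. Conventions: $\mathbb N_0=\{0,1,2,\dots\}$, $\log0=-\infty$, $\log\infty=\infty$. *)

(* Defs.v *)
From HB Require Import structures.
From mathcomp Require Import all_boot all_order all_algebra.
From mathcomp Require Import all_classical all_reals all_analysis.
From mathcomp Require Import measurable_realfun.

Set Implicit Arguments.
Unset Strict Implicit.
Unset Printing Implicit Defensive.

Import Order.TTheory GRing.Theory Num.Theory.
Import numFieldNormedType.Exports.

Local Open Scope classical_set_scope.
Local Open Scope ring_scope.

Definition filtration d (T : measurableType d) (F : nat -> set (set T)) : Prop :=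
  [/\ forall t, sigma_algebra [set: T] (F t),
      forall s t, (s <= t)%N -> F s `<=` F t
    & forall t, F t `<=` measurable].

(* Times in {0, 1, 2, ...} U {oo} are elements of option nat, None being oo. *)
Definition time_le (s : option nat) (t : nat) : bool :=
  if s is Some n then (n <= t)%N else false.

Definition time_ereal (R : realType) (s : option nat) : \bar R :=
  if s is Some n then (n%:R)%:E else +oo%E.

Definition stopping_time (T : Type) (F : nat -> set (set T))
    (tau : T -> option nat) : Prop :=
  forall t : nat, F t [set w | time_le (tau w) t].

Definition adapted (R : realType) (T : Type) (F : nat -> set (set T))
    (M : nat -> T -> \bar R) : Prop :=
  forall (t : nat) (B : set (\bar R)), measurable B -> F t (M t @^-1` B).

(* A finite stopping time is a nat-valued function sigma. *)
Definition e_process (R : realType) d (T : measurableType d)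
    (F : nat -> set (set T)) (PP : set (probability T R))
    (M : nat -> T -> \bar R) : Prop :=
  [/\ forall t w, (0 <= M t w)%E,
      adapted F M
    & forall P : probability T R, PP P ->
      forall sigma : T -> nat, stopping_time F (Some \o sigma) ->
      (\int[P]_w M (sigma w) w <= 1)%E].

Definition loglog_weight (R : realType) (k : nat) : R :=
  (k%:R * ln k%:R * (ln (ln k%:R)) ^+ 2)^-1.

Definition S_star (R : realType) (k0 : nat) : \bar R :=
  (\sum_(k0 <= k <oo) (loglog_weight R k)%:E)%E.

(* [fine] sends +oo to 0 and the inverse of 0 is 0, so c_star would be
   1 / oo = 0 if the series diverged. *)
Definition c_star (R : realType) (k0 : nat) : R := (fine (S_star R k0))^-1.

Definition gamma (R : realType) (k0 k : nat) : R :=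
  c_star R k0 * loglog_weight R k.

(* tau k is the stopping time attached to the level gamma_k; its values at
   k < k0 are not used. *)
Definition G (R : realType) (T : Type) (k0 : nat) (tau : nat -> T -> option nat)
    (t : nat) (w : T) : \bar R :=
  (\sum_(k0 <= k <oo) (\1_[set v | time_le (tau k v) t] w)%:E)%E.

(* Main.v *)
(* Since the derivative of [- 1 / log log x] is the weight
   [1 / (x log x (log log x)^2)], the weights are dominated by a telescoping
   series; this gives [S_star < oo] and [\sum_k gamma_k = 1].  Pointwise
   [G_sigma <= \sum_k 1_{tau_k < oo}], whose expectation is at most
   [\sum_k gamma_k].
   For the rate, [log (1 / gamma_k) ~ log k], so on almost every path
   [log k / tau_k -> I]: if [a < I < b], then for [k] past some [K] one has
   [exp (a tau_k) < k < exp (b tau_k)], hence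
   [exp (a t) - K <= G_t <= exp (b t) + K + 1]. *)

Require Import Defs.
From HB Require Import structures.
From mathcomp Require Import all_boot all_order all_algebra.
From mathcomp Require Import all_classical all_reals all_analysis.
From mathcomp Require Import measurable_realfun.
From mathcomp Require Import ring lra.

Set Implicit Arguments.
Unset Strict Implicit.
Unset Printing Implicit Defensive.

Import Order.TTheory GRing.Theory Num.Theory.
Import numFieldNormedType.Exports.

Local Open Scope classical_set_scope.
Local Open Scope ring_scope.

(** * Convergence of the series of weights and normalisation of [gamma] *)

Lemma ln_ge1BV (R : realType) (x : R) : 0 < x -> 1 - x^-1 <= ln x.
Proof.
move=> x0; have xV0 : 0 < x^-1 by rewrite invr_gt0.
have := @le_ln1Dx R (x^-1 - 1).
rewrite addrCA subrr addr0 lnV// ltrBrDr addNr => /(_ xV0).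
by rewrite lerNl opprB.
Qed.

(** A mean value bound without derivatives: [1 - 1/u <= ln u] at [u = y / x]. The telescoping
    estimate uses it once for [ln] and once for [ln ln]. *)
Lemma ln_sub_ge (R : realType) (x y : R) : 0 < x -> 0 < y ->
  (y - x) / y <= ln y - ln x.
Proof.
move=> x0 y0; rewrite -ln_div//.
apply: le_trans (ln_ge1BV (divr_gt0 y0 x0)).
by rewrite invf_div mulrBl divff// gt_eqF.
Qed.

Lemma ln_nat_ge2 (R : realType) (k : nat) : (16 <= k)%N -> 2 <= ln (k%:R : R).
Proof.
move=> k16; have h2 : 0 < 2 :> R by lra.
(* The crude bound [ln 2 >= 1/2] is enough, since [16 = 2 ^ 4]. *)
have ln2 : 1 - 2^-1 <= ln (2 : R) by exact: ln_ge1BV.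
have : ln (2 ^+ 4 : R) <= ln k%:R.
  by rewrite ler_ln ?posrE ?exprn_gt0// -?natrX ?ltr0n ?ler_nat ?(leq_trans _ k16).
by rewrite lnXn// => h; rewrite (le_trans _ h)//; lra.
Qed.

Lemma loglog_weight_ge0 (R : realType) (k : nat) : 0 <= loglog_weight R k.
Proof.
rewrite invr_ge0; apply: mulr_ge0 (sqr_ge0 _); apply: mulr_ge0 => //.
by case: k => [|k]; [rewrite ln0|rewrite ln_ge0// ler1n].
Qed.

Section loglog.
Variables (R : realType) (k : nat).
Hypothesis k16 : (16 <= k)%N.

Lemma natr16_gt0 : 0 < k%:R :> R.
Proof. by rewrite ltr0n (leq_trans _ k16). Qed.

Lemma ln_nat_gt0 : 0 < ln (k%:R : R).
Proof. by rewrite (lt_le_trans _ (ln_nat_ge2 R k16)). Qed.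

Lemma lnln_nat_gt0 : 0 < ln (ln (k%:R : R)).
Proof. by rewrite ln_gt0// (lt_le_trans _ (ln_nat_ge2 R k16))// ltr1n. Qed.

Lemma loglog_weight_gt0 : 0 < loglog_weight R k.
Proof.
by rewrite invr_gt0 !mulr_gt0 ?exprn_gt0 ?natr16_gt0 ?ln_nat_gt0 ?lnln_nat_gt0.
Qed.

End loglog.

(** Let [u], [v] be [ln ln] of [k], [k+1]. Two uses of [ln_sub_ge] give
    [v - u >= 1 / ((k+1) ln (k+1))], and [u v <= v^2], so [1/u - 1/v = (v - u) / (u v)] dominates
    the weight at [k+1]. *)
Lemma loglog_weight_telescope (R : realType) (k : nat) : (16 <= k)%N ->
  loglog_weight R k.+1 <=
  (ln (ln (k%:R : R)))^-1 - (ln (ln (k.+1%:R : R)))^-1.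
Proof.
move=> k16; have k16' := leqW k16.
have ltk : k%:R < k.+1%:R :> R by rewrite ltr_nat.
rewrite /loglog_weight.
have := ln_nat_gt0 R k16; have := ln_nat_gt0 R k16'.
have := natr16_gt0 R k16; have := natr16_gt0 R k16'.
set x := k%:R; set y := k.+1%:R => y0 x0.
have dL : y^-1 <= ln y - ln x.
  have := ln_sub_ge x0 y0.
  by rewrite (_ : y - x = 1) ?mul1r// /y /x -natrB// subSnn.
have leL : ln x <= ln y by rewrite ler_ln ?posrE// ltW.
have := lnln_nat_gt0 R k16; have := lnln_nat_gt0 R k16'.
rewrite -/x -/y; set L := ln x; set M := ln y => M2 L2 M0 L0.
have dM : (y * M)^-1 <= ln M - ln L.
  apply: le_trans (ln_sub_ge L0 M0).
  by rewrite invfM ler_pM2r ?invr_gt0.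
have le2 : ln L <= ln M by rewrite ler_ln ?posrE.
have -> : (ln L)^-1 - (ln M)^-1 = (ln M - ln L) / (ln L * ln M).
  by field; rewrite !gt_eqF.
rewrite invfM; apply: ler_pM => //.
- by rewrite invr_ge0 mulr_ge0// ltW.
- by rewrite invr_ge0 exprn_ge0// ltW.
- by rewrite lef_pV2 ?posrE ?mulr_gt0 ?exprn_gt0// expr2 ler_pM2r.
Qed.

Lemma loglog_weight_psum (R : realType) (k0 n : nat) : (16 <= k0)%N ->
  \sum_(k0 <= k < n) loglog_weight R k <=
  loglog_weight R k0 + (ln (ln (k0%:R : R)))^-1.
Proof.
move=> k16.
have pos : 0 <= loglog_weight R k0 + (ln (ln (k0%:R : R)))^-1.
  by rewrite addr_ge0 ?loglog_weight_ge0// invr_ge0 ltW// lnln_nat_gt0.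
have [nk|] := leqP n k0; first by rewrite big_geq.
case: n => // n; rewrite ltnS => kn.
(* The telescoping bound reaches the weight at [i+1] from index [i], so the term at [k0] is kept
   apart. *)
rewrite big_nat_recl// lerD2l.
have tele : \sum_(k0 <= i < n) loglog_weight R i.+1 <=
    (ln (ln (k0%:R : R)))^-1 - (ln (ln (n%:R : R)))^-1.
  rewrite -[leRHS]opprB -(telescope_sumr (fun i => (ln (ln (i%:R : R)))^-1))//.
  rewrite -sumrN; apply: ler_sum_nat => i /andP[ki _].
  by rewrite opprB loglog_weight_telescope// (leq_trans k16 ki).
apply: le_trans tele _; rewrite lerBlDr lerDl invr_ge0 ltW// lnln_nat_gt0//.
exact: leq_trans kn.
Qed.

Lemma S_star_lty (R : realType) (k0 : nat) : (16 <= k0)%N ->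
  (S_star R k0 < +oo)%E.
Proof.
move=> k16.
apply: (@le_lt_trans _ _ (loglog_weight R k0 + (ln (ln (k0%:R : R)))^-1)%:E);
  last exact: ltry.
apply: lime_le.
  by apply: is_cvg_nneseries => i _ _; rewrite lee_fin loglog_weight_ge0.
by apply: nearW => n; rewrite sumEFin lee_fin loglog_weight_psum.
Qed.

Lemma S_star_gt0 (R : realType) (k0 : nat) : (16 <= k0)%N ->
  (0 < S_star R k0)%E.
Proof.
move=> k16; apply: (@lt_le_trans _ _ (loglog_weight R k0)%:E).
  by rewrite lte_fin loglog_weight_gt0.
have := @nneseries_lim_ge R (fun k => (loglog_weight R k)%:E) xpredT k0 k0.+1.
rewrite big_nat1; apply => i _ _.
by rewrite lee_fin loglog_weight_ge0.
Qed.

Lemma c_star_gt0 (R : realType) (k0 : nat) : (16 <= k0)%N -> 0 < c_star R k0.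
Proof. by move=> k16; rewrite invr_gt0 fine_gt0// S_star_gt0 ?S_star_lty. Qed.

(** As [S_star] is finite and positive, [c_star] is its true inverse and no default value
    intervenes. *)
Lemma gamma_sum (R : realType) (k0 : nat) : (16 <= k0)%N ->
  (\sum_(k0 <= k <oo) (gamma R k0 k)%:E)%E = 1%E.
Proof.
move=> k16; have S0 := S_star_gt0 R k16; have Soo := S_star_lty R k16.
under eq_eseriesr do rewrite EFinM.
rewrite nneseriesZl; last by move=> k _; rewrite lee_fin loglog_weight_ge0.
rewrite -/(S_star R k0) /c_star.
rewrite -[X in (_ * X)%E](@fineK _ (S_star R k0)) ?ge0_fin_numE// ?ltW//.
by rewrite -EFinM mulVf// gt_eqF// fine_gt0// S0.
Qed.

(** * Asymptotics of [ln (1 / gamma_k)] and inversion of the rate *)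

Lemma cvg_ln_natr (R : realType) : (ln n%:R : R) @[n --> \oo] --> +oo.
Proof.
apply/cvgryPge => A; near=> n.
rewrite -[A]expRK ler_ln ?posrE ?expR_gt0//.
  by near: n; exact: nbhs_infty_ger.
by rewrite (lt_le_trans (expR_gt0 A))//; near: n; exact: nbhs_infty_ger.
Unshelve. all: by end_near. Qed.

(** This is [ln u < u] at [u = d x]: the slope [d] may be as small as desired, at the price of a
    constant. *)
Lemma ln_le_linear (R : realType) (d x : R) : 0 < d -> 0 < x ->
  ln x <= d * x - ln d.
Proof.
move=> d0 x0; rewrite lerBrDl -lnM ?posrE//.
by rewrite ltW// ln_sublinear// mulr_gt0.
Qed.

Lemma ln_gammaV (R : realType) (k0 k : nat) : (16 <= k0)%N -> (16 <= k)%N ->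
  ln (1 / gamma R k0 k) =
  ln (k%:R : R) + (ln (ln k%:R) + ln (ln (ln k%:R)) *+ 2 - ln (c_star R k0)).
Proof.
move=> k016 k16; rewrite /gamma; move: (c_star R k0) (c_star_gt0 R k016) => c c0.
rewrite div1r invfM invrK.
have := (natr16_gt0 R k16, ln_nat_gt0 R k16, lnln_nat_gt0 R k16).
move=> [[k0' L0] L2].
rewrite lnM ?posrE ?invr_gt0 ?mulr_gt0 ?exprn_gt0//.
rewrite lnV ?posrE// lnM ?posrE ?mulr_gt0 ?exprn_gt0//.
by rewrite lnM ?posrE// lnXn// addrC !addrA.
Qed.

Lemma cvg_ln_gammaV (R : realType) (k0 : nat) : (16 <= k0)%N ->
  (ln (1 / gamma R k0 k) / ln (k%:R : R)) @[k --> \oo] --> (1 : R).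
Proof.
move=> k016; apply/cvgrPdist_le => e e0.
(* With [L = ln k], the correction to [L] is at most [3 ln L + |ln c_star|]. Slope [e/6] bounds this
   by [(e/2) L + C], and [C <= (e/2) L] for large [k]. *)
have d0 : 0 < e / 6 by rewrite divr_gt0.
set C := `|ln (c_star R k0)| - 3 * ln (e / 6).
near=> k.
have k16 : (16 <= k)%N by near: k; exact: nbhs_infty_ge.
rewrite ln_gammaV//; have [L0 L2] := (ln_nat_gt0 R k16, lnln_nat_gt0 R k16).
(* This makes [ln L >= 1], hence [ln (ln L) >= 0]. *)
have Lexp : expR (expR 0) <= ln (k%:R : R).
  by near: k; apply: (cvgryPge _).1; exact: cvg_ln_natr.
have LC : 2 / e * C <= ln (k%:R : R).
  by near: k; apply: (cvgryPge _).1; exact: cvg_ln_natr.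
set L := ln k%:R in L0 L2 Lexp LC *.
have LL1 : expR 0 <= ln L.
  by rewrite -[leLHS]expRK ler_ln ?posrE ?expR_gt0.
have LLL0 : 0 <= ln (ln L) by rewrite ln_ge0// -expR0.
have LLL : ln (ln L) <= ln L by rewrite ltW// ln_sublinear.
have LLe := ln_le_linear d0 L0.
rewrite mulrDl divff ?gt_eqF// opprD addrA subrr sub0r normrN.
rewrite normrM normfV (gtr0_norm L0) ler_pdivrMr//.
have {}LC : C <= e / 2 * L.
  by rewrite -[e / 2]invf_div mulrC ler_pdivlMr ?divr_gt0// mulrC.
have c1 := ler_norm (ln (c_star R k0)); have c2 := ler_norm (- ln (c_star R k0)).
rewrite normrN in c2.
move: LC LLe; rewrite /C (_ : e / 6 * L = e * L / 6); last by field.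
rewrite (_ : e / 2 * L = e * L / 2); last by field.
move: (e * L) => eL.
move=> LC LLe; rewrite ler_norml -mulr_natr; apply/andP; split; lra.
Unshelve. all: by end_near. Qed.

(** Multiplying by [ln (1 / gamma_k) / ln k -> 1] replaces the denominator by [ln k]; the limit
    [1 / I] is nonzero, so the quotient can be inverted. *)
Lemma cvg_ln_div_time (R : realType) (k0 : nat) (I : R) (s : nat -> R) :
  (16 <= k0)%N -> 0 < I ->
  s k / ln (1 / gamma R k0 k) @[k --> \oo] --> 1 / I ->
  ln (k%:R : R) / s k @[k --> \oo] --> I.
Proof.
move=> k016 I0 sI.
have gL := @cvg_ln_gammaV R k0 k016.
have : (s k / ln (1 / gamma R k0 k)) * (ln (1 / gamma R k0 k) / ln (k%:R : R))
   @[k --> \oo] --> 1 / I * 1 by exact: cvgM.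
rewrite mulr1 => /cvgV; rewrite mul1r invrK invr_neq0 ?gt_eqF// => /(_ isT).
apply: cvg_trans; apply: near_eq_cvg; near=> k.
have g0 : 0 < ln (1 / gamma R k0 k) / ln (k%:R : R).
  by near: k; exact: (cvgr_gt 1).
have {}g0 : ln (1 / gamma R k0 k) != 0.
  by apply: contraTneq g0 => ->; rewrite mul0r ltxx.
by rewrite /= mulrA divfK// invf_div.
Unshelve. all: by end_near. Qed.

(** * The e-process property *)

Lemma measurable_indic_series (R : realType) d (T : measurableType d) (k0 : nat)
    (A : nat -> set T) : (forall k, (k0 <= k)%N -> measurable (A k)) ->
  measurable_fun [set: T]
    (fun w => (\sum_(k0 <= k <oo) (\1_(A k) w : R)%:E)%E).
Proof.
move=> mA.
under eq_fun do rewrite eseries_cond.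
apply: (@ge0_emeasurable_sum _ _ _ _ (fun k w => (\1_(A k) w : R)%:E)
  (fun k => (k0 <= k)%N)) => [k w _ _|k kk0]; first by rewrite lee_fin.
exact/measurable_EFinP/measurable_indic/mA.
Qed.

Lemma integral_indic_series (R : realType) d (T : measurableType d)
    (mu : {measure set T -> \bar R}) (k0 : nat)
    (A : nat -> set T) : (forall k, (k0 <= k)%N -> measurable (A k)) ->
  (\int[mu]_w (\sum_(k0 <= k <oo) (\1_(A k) w : R)%:E) =
   \sum_(k0 <= k <oo) mu (A k))%E.
Proof.
move=> mA.
(* Terms below [k0] become 0, so that every term is measurable although [A k] is only assumed so
   from [k0] on. *)
under eq_integral => w _ do rewrite eseries_cond eseries_mkcond.
rewrite integral_nneseries//; last 2 first.
- move=> k /=; case: (boolP (k0 <= k)%N) => [kk0|_]; last exact: measurable_cst.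
  exact/measurable_EFinP/measurable_indic/mA.
- by move=> k w _; case: ifP => // _; rewrite lee_fin.
rewrite [RHS]eseries_cond [RHS]eseries_mkcond; apply: eq_eseriesr => k _ /=.
case: (boolP (k0 <= k)%N) => kk0; last by rewrite integral0.
by rewrite integral_indic ?setIT//; exact: mA.
Qed.

Lemma adapted_G (R : realType) d (T : measurableType d)
    (F : nat -> set (set T)) (k0 : nat) (tau : nat -> T -> option nat) :
  filtration F -> (forall k, (k0 <= k)%N -> stopping_time F (tau k)) ->
  adapted F (G R k0 tau).
Proof.
move=> [sF _ _] htau t B mB.
(* [F t] becomes the sigma-algebra of an auxiliary measurable type, where the general measurability
   lemma applies. *)
have FE : (F t).-sigma.-measurable = F t by exact: measurable_g_measurableTypeE.
have := @measurable_indic_series R _ (g_sigma_algebraType (F t)) k0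
  (fun k => [set w | time_le (tau k w) t]).
rewrite FE => /(_ (fun k kk0 => htau k kk0 t)) mG.
by have := mG measurableT B mB; rewrite setTI FE.
Qed.

Lemma e_process_G (R : realType) d (T : measurableType d)
    (F : nat -> set (set T)) (hF : filtration F) (PP : set (probability T R))
    (k0 : nat) (hk0 : (16 <= k0)%N) (tau : nat -> T -> option nat)
    (htau : forall k, (k0 <= k)%N -> stopping_time F (tau k))
    (hlevel : forall k, (k0 <= k)%N ->
      (ereal_sup [set P [set w | tau k w <> None] | P in PP]
         <= (gamma R k0 k)%:E)%E) :
  e_process F PP (G R k0 tau).
Proof.
split; first by move=> t w; apply: nneseries_ge0 => k _ _; rewrite lee_fin.
  exact: adapted_G.
move=> P PPP sigma hsigma.
have [_ Fle Fm] := hF.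
pose A k := [set w | time_le (tau k w) (sigma w)].
have mtau k t : (k0 <= k)%N -> measurable [set w | time_le (tau k w) t].
  by move=> kk0; apply: (Fm t); exact: htau.
have msig t : measurable [set w | (sigma w <= t)%N].
  by apply: (Fm t); exact: hsigma.
have mA k : (k0 <= k)%N -> measurable (A k).
  move=> kk0.
  (* [tau k <= sigma] holds iff [tau k <= t <= sigma] for some [t]; the condition [t <= sigma] is
     the complement of [sigma <= t - 1], and for [t = 0] nothing is removed. *)
  rewrite (_ : A k = \bigcup_t ([set w | time_le (tau k w) t] `\`
                                [set w | (sigma w < t)%N])).
    apply: bigcupT_measurable => t; apply: measurableD; first exact: mtau.
    case: t => [|t]; last exact: msig.
    by rewrite (_ : [set _ | _] = set0)// -subset0.
  apply/seteqP; split => w /=.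
    by move=> h; exists (sigma w) => //; split => //=; rewrite ltnn.
  move=> [t _ [/= h /negP]]; rewrite -leqNgt /A/=.
  by move: h; case: (tau k w) => //= n; exact: leq_trans.
have mfin k : (k0 <= k)%N -> measurable [set w | tau k w <> None].
  move=> kk0.
  rewrite (_ : [set _ | _] = \bigcup_t [set w | time_le (tau k w) t]).
    by apply: bigcupT_measurable => t; exact: mtau.
  apply/seteqP; split => w /=; last by move=> [t _] /=; case: (tau k w).
  by case E: (tau k w) => [n|]// _; exists n => //=; rewrite E/=.
have -> : (\int[P]_w G R k0 tau (sigma w) w =
    \int[P]_w (\sum_(k0 <= k <oo) (\1_(A k) w : R)%:E))%E.
  apply: eq_integral => w _; apply: eq_eseriesr => k _.
  by [].
rewrite integral_indic_series// -(gamma_sum R hk0).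
rewrite eseries_cond [leRHS]eseries_cond.
apply: lee_nneseries => // k kk0.
rewrite /= in kk0.
apply: le_trans (hlevel k kk0).
apply: (@le_trans _ _ (P [set w | tau k w <> None])).
  apply: le_measure; rewrite ?inE; [exact: mA|exact: mfin|].
  by move=> w; rewrite /A /=; case: (tau k w).
by apply: ereal_sup_ubound; exists P.
Qed.

(** * Exponential growth of the count along a single path *)

Lemma expR_superadd (R : realType) (x y : R) : 0 <= x -> 0 <= y ->
  expR x + y <= expR (x + y).
Proof.
move=> x0 y0; rewrite expRD.
have x1 : 1 <= expR x by rewrite -expR0 ler_expR.
have y1 := expR_ge1Dx y; rewrite -subr_ge0.
(* This sum of two nonnegative products equals [expR x * expR y - (expR x + y)]. *)
have : 0 <= expR x * (expR y - (1 + y)) + (expR x - 1) * y.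
  by rewrite addr_ge0// mulr_ge0 ?subr_ge0 ?expR_ge0.
by congr (_ <= _); ring.
Qed.

Section count.
Variables (R : realType) (k0 : nat) (s : nat -> option nat).

(** The value of [G] along one path, [s k] standing for [tau k w]; the rate thus becomes a
    deterministic statement. *)
Definition time_count (t : nat) : \bar R :=
  (\sum_(k0 <= k <oo) ((time_le (s k) t)%:R)%:E)%E.

Lemma time_count_le (t M : nat) : (forall k, time_le (s k) t -> (k < M)%N) ->
  (time_count t <= M%:R%:E)%E.
Proof.
move=> sM; apply: lime_le.
  by apply: is_cvg_nneseries => k _ _; rewrite lee_fin.
apply: nearW => n; rewrite sumEFin lee_fin -natr_sum ler_nat.
apply: (@leq_trans (\sum_(k0 <= k < n) (k < M)%N)).
  by apply: leq_sum => k _; case: (boolP (time_le _ _)) => // /sM ->.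
apply: (@leq_trans (\sum_(0 <= k < n) (k < M)%N)).
  have [k0n|nk0] := leqP k0 n; last by rewrite big_geq// ltnW.
  by rewrite [leqRHS](@big_cat_nat _ _ _ k0)//= leq_addl.
(* Up to [M] there are at most [M] terms, each at most 1; every later term vanishes. *)
elim: n => [|n IH]; first by rewrite big_geq.
have [nM|Mn] := leqP n.+1 M.
  apply: leq_trans nM; rewrite -[leqRHS]subn0 -[leqRHS]muln1 -sum_nat_const_nat.
  by apply: leq_sum => k _; exact: leq_b1.
by rewrite big_nat_recr//= (leq_gtF (Mn : (M <= n)%N)) addn0.
Qed.

Lemma time_count_ge (t K n : nat) : (k0 <= K)%N ->
  (forall k, (K <= k < n)%N -> time_le (s k) t) ->
  ((n%:R - K%:R)%:E <= time_count t)%E.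
Proof.
move=> k0K sK.
apply: le_trans (nneseries_lim_ge n _) => [|k _ _]; last by rewrite lee_fin.
rewrite sumEFin lee_fin -natr_sum lerBlDr -natrD ler_nat.
rewrite addnC -leq_subLR.
have [nK|Kn] := leqP n K; first by rewrite (eqP nK).
rewrite (@big_cat_nat _ _ _ K)//=; last exact: ltnW.
apply: leq_trans (leq_addl _ _).
rewrite -[leqLHS]muln1 -sum_nat_const_nat !big_nat.
by apply: leq_sum => k /sK ->.
Qed.

Variable I : R.
Hypotheses (sfin : \forall k \near \oo, s k != None) (I0 : 0 < I).
Hypothesis sI : ln (k%:R : R) / (odflt 0%N (s k))%:R @[k --> \oo] --> I.

(** For [a < a' < I], each large [k <= exp (a' t)] has [a' s_k < ln k <= a' t], so it is counted.
    The factor [exp ((a' - a) t)] pays for the finitely many initial indices. *)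
Lemma time_count_near_ge (a : R) : 0 < a -> a < I ->
  \forall t \near \oo, ((expR (a * t%:R))%:E <= time_count t)%E.
Proof.
move=> a0 aI; pose a' := (a + I) / 2.
have aa' : 0 < a' - a by rewrite /a'; lra.
have a'I : a' < I by rewrite /a'; lra.
have [K _ KP] : \forall k \near \oo, s k != None /\
    a' < ln (k%:R : R) / (odflt 0%N (s k))%:R.
  by near=> k; split; near: k => //; exact: (cvgr_gt I).
near=> t.
set n := (Num.trunc (expR (a' * t%:R))).+1.
apply: (@le_trans _ _ (n%:R - (maxn k0 K)%:R)%:E).
  rewrite lee_fin lerBrDr.
  have tK : (maxn k0 K)%:R <= (a' - a) * t%:R.
    rewrite mulrC -ler_pdivrMr//; near: t; exact: nbhs_infty_ger.
  apply: (@le_trans _ _ (expR (a' * t%:R))); last exact/ltW/truncnS_gt.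
  rewrite [a' in leRHS](_ : _ = a + (a' - a)); last by rewrite addrC subrK.
  rewrite mulrDl; apply: le_trans (expR_superadd _ _); first by rewrite lerD2l.
    by rewrite mulr_ge0// ltW.
  by rewrite mulr_ge0// ltW.
apply: time_count_ge; first exact: leq_maxl.
move=> k /andP[kK]; rewrite ltnS => kn.
have k1 : (K <= k)%N by exact: leq_trans (leq_maxr _ _) kK.
have [] := KP k k1; case: (s k) => //= m _ am.
(* A quotient by 0 is 0, which is not above [a' > 0]. *)
have m0 : 0 < m%:R :> R.
  rewrite lt0r ler0n andbT; apply: contraTneq am => ->.
  by rewrite invr0 mulr0 -leNgt; lra.
move: am; rewrite ltr_pdivlMr// => am.
rewrite -(ler_nat R) -(@ler_pM2l _ a'); last lra.
apply: (le_trans (ltW am)).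
have k0' : 0 < k%:R :> R.
  rewrite lt0r ler0n andbT; apply: contraTneq am => ->.
  by rewrite ln0// -leNgt mulr_ge0// ltW//; lra.
rewrite -[leRHS]expRK ler_ln ?posrE ?expR_gt0//.
by rewrite (@le_trans _ _ (Num.trunc (expR (a' * t%:R)))%:R) ?ler_nat//
  truncn_le expR_ge0.
Unshelve. all: by end_near. Qed.

(** For [I < b' < b], a counted [k >= K] has [ln k < b' s_k <= b' t], so at most
    [exp (b' t) + 1 + K] indices are counted; the excess is absorbed in [exp ((b - b') t)]. *)
Lemma time_count_near_le (b : R) : I < b ->
  \forall t \near \oo, (time_count t <= (expR (b * t%:R))%:E)%E.
Proof.
move=> Ib; pose b' := (I + b) / 2.
have bb' : 0 < b - b' by rewrite /b'; lra.
have b'I : I < b' by rewrite /b'; lra.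
have b'0 := lt_trans I0 b'I.
(* The lower bound 0 excludes [s k = Some 0], where the quotient is 0 by convention and the upper
   bound carries no information. *)
have [K _ KP] : \forall k \near \oo, [/\ s k != None,
    0 < ln (k%:R : R) / (odflt 0%N (s k))%:R &
    ln (k%:R : R) / (odflt 0%N (s k))%:R < b'].
  by near=> k; split; near: k => //; [exact: (cvgr_gt I)|exact: (cvgr_lt I)].
near=> t.
set n := (Num.trunc (expR (b' * t%:R))).+1.
apply: (@le_trans _ _ (K + n)%:R%:E).
  apply: time_count_le => k; have [kK _|Kk] := ltnP k K.
    by rewrite (leq_trans kK)// leq_addr.
  have [] := KP k Kk; case: (s k) => //= m _ m0 bm mt.
  have {}m0 : 0 < m%:R :> R.
    rewrite lt0r ler0n andbT; apply: contraTneq m0 => ->.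
    by rewrite invr0 mulr0 ltxx.
  apply: leq_trans (leq_addl _ _).
  rewrite -(ltr_nat R); apply: le_lt_trans (truncnS_gt _).
  have [->|k1] := posnP k; first exact: expR_ge0.
  rewrite -[leLHS]lnK ?posrE ?ltr0n// ler_expR.
  move: bm; rewrite ltr_pdivrMr// => /ltW/le_trans; apply.
  by rewrite ler_pM2l ?ler_nat.
rewrite lee_fin.
(* The extra 1 is the one in [n = trunc + 1]. *)
have tK : (K.+1)%:R <= (b - b') * t%:R.
  rewrite mulrC -ler_pdivrMr//; near: t; exact: nbhs_infty_ger.
rewrite [b in leRHS](_ : _ = b' + (b - b')); last by rewrite addrC subrK.
rewrite mulrDl; apply: le_trans (expR_superadd _ _).
- rewrite /n addnS -addSn natrD addrC lerD//.
  by rewrite truncn_le// expR_ge0.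
- by rewrite mulr_ge0//; lra.
- by rewrite mulr_ge0// ltW.
Unshelve. all: by end_near. Qed.

Lemma cvg_lne_time_count :
  ((1 / t%:R)%:E * lne (time_count t))%E @[t --> \oo] --> I%:E.
Proof.
(* The witness [x] records both finiteness and closeness to [I], the two halves of [fine_cvgP]. *)
have near_bound (e : R) : 0 < e -> \forall t \near \oo,
    exists2 x : R, ((1 / t%:R)%:E * lne (time_count t))%E = x%:E & `|I - x| <= e.
  move=> e0; have [e' [e'0 e'e e'I]] : exists e', [/\ 0 < e', e' <= e & e' < I].
    (* The cap [I / 2] keeps [I - e'] positive, as the lower bound on the count requires. *)
    exists (Num.min e (I / 2)); rewrite lt_min e0 ge_min lexx gt_min /=.
    split; [exact: divr_gt0|exact: isT|]. by apply/orP; right; move: I0; lra.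
  near=> t.
  have t0 : 0 < t%:R :> R by near: t; exact: nbhs_infty_gtr.
  have : ((expR ((I - e') * t%:R))%:E <= time_count t)%E.
    by near: t; apply: time_count_near_ge; lra.
  have : (time_count t <= (expR ((I + e') * t%:R))%:E)%E.
    by near: t; apply: time_count_near_le; lra.
  case: (time_count t) => [g| |]//; rewrite !lee_fin => gle leg.
  have g0 := lt_le_trans (expR_gt0 _) leg.
  rewrite lne_EFin// -EFinM; exists (1 / t%:R * ln g) => //.
  rewrite mul1r mulrC distrC ler_norml.
  have h1 : I - e' <= ln g / t%:R.
    by rewrite ler_pdivlMr// -[leLHS]expRK ler_ln ?posrE ?expR_gt0.
  have h2 : ln g / t%:R <= I + e'.
    by rewrite ler_pdivrMr// -[leRHS]expRK ler_ln ?posrE ?expR_gt0.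
  by apply/andP; split; lra.
apply/fine_cvgP; split.
  by apply: filterS (near_bound 1 ltr01) => t [x -> _].
apply/cvgrPdist_le => e e0.
by apply: filterS (near_bound e e0) => t [x /= -> ].
Unshelve. all: by end_near. Qed.

End count.

(** * Assembly: passing from almost sure convergence to single paths *)

Theorem corollaryD4 (R : realType) (d : measure_display) (T : measurableType d)
    (F : nat -> set (set T)) (hF : filtration F)
    (PP : set (probability T R)) (Q : probability T R)
    (I : R) (hI : 0 < I) (k0 : nat) (hk0 : (16 <= k0)%N)
    (tau : nat -> T -> option nat)
    (htau : forall k, (k0 <= k)%N -> stopping_time F (tau k))
    (hlevel : forall k, (k0 <= k)%N ->
      (ereal_sup [set P [set w | tau k w <> None] | P in PP]
         <= (gamma R k0 k)%:E)%E)
    (hrate : {ae Q, forall w,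
      (fun k => (time_ereal R (tau k w) / (ln (1 / gamma R k0 k))%:E)%E)
        @ \oo --> (1 / I)%:E}) :
  [/\ (S_star R k0 < +oo)%E,
      e_process F PP (G R k0 tau)
    & {ae Q, forall w,
        (fun t : nat => ((1 / t%:R)%:E * lne (G R k0 tau t w))%E)
          @ \oo --> I%:E}].
Proof.
split; [exact: S_star_lty|exact: e_process_G|].
apply: filterS hrate => w rate.
have GE t : G R k0 tau t w = time_count R k0 (tau ^~ w) t.
  by apply: eq_eseriesr => k _; rewrite indicE; congr ((nat_of_bool _)%:R%:E); exact: asboolb.
under eq_fun do rewrite GE.
have [fin_rate lim_rate] := (fine_cvgP _ _).1 rate.
have g0 : \forall k \near \oo, 0 < ln (1 / gamma R k0 k).
  near=> k; have L0 : 0 < ln (k%:R : R).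
    by apply: ln_nat_gt0; near: k; exact: nbhs_infty_ge.
  rewrite -(pmulr_lgt0 _ (_ : 0 < (ln (k%:R : R))^-1)) ?invr_gt0//.
  by near: k; apply: (cvgr_gt 1) => //; exact: cvg_ln_gammaV.
(* An infinite [tau k w] over a positive denominator would give [+oo], against the finite limit. *)
have sfin : \forall k \near \oo, tau k w != None.
  near=> k.
  have : 0 < ln (1 / gamma R k0 k) by near: k.
  have : (time_ereal R (tau k w) / (ln (1 / gamma R k0 k))%:E)%E \is a fin_num.
    by near: k.
  case: (tau k w) => //= + l0; rewrite inver gt_eqF//.
  by rewrite gt0_mulye// lte_fin invr_gt0.
apply: cvg_lne_time_count => //.
apply: (@cvg_ln_div_time R k0) => //.
(* With [tau k w] finite and the denominator nonzero, the extended quotient is the real one. *)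
apply: cvg_trans lim_rate; apply: near_eq_cvg; near=> k.
have : 0 < ln (1 / gamma R k0 k) by near: k.
have : tau k w != None by near: k.
rewrite /=; case: (tau k w) => //= n _ l0.
by rewrite inver gt_eqF.
Unshelve. all: by end_near. Qed.
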